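(* Let $G$ be a connected finite simple bipartite graph and $k$ a positive integer. Then a $k$-restraint $r$ on $G$ belongs to $R_{\max}(G,k)$ if and only if $r\simeq r_{alt}$, where $r_{alt}$ is an alternating $k$-restraint on $G$.
   Context: A restraint $r$ on a graph $G$ assigns to each vertex $v$ a finite set $r(v)\subset\mathbb{N}$ of forbidden colours; a proper $x$-colouring $c$ of $G$ is permitted by $r$ if $c(v)\notin r(v)$ for all $v$, and $\pi_r(G,x)$ denotes the number of proper $x$-colourings permitted by $r$. If $G$ has $n$ vertices, a $k$-restraint is a restraint with $|r(v)|=k$ and $r(v)\subseteq\{1,2,\dots,kn\}$ for every vertex $v$. $R_{\max}(G,k)$ is the set of $k$-restraints $r$ on $G$ such that for every $k$-restraint $r'$ on $G$, $\pi_r(G,x)\geq\pi_{r'}(G,x)$ for all sufficiently large $x$. For a connected bipartite graph with bipartition $(V_1,V_2)$, an alternating $k$-restraint $r_{alt}$ is a $k$-restraint that is constant on $V_1$ and constant on $V_2$ and satisfies $r_{alt}(u)\cap r_{alt}(v)=\emptyset$ for $u\in V_1$, $v\in V_2$ (all alternating $k$-restraints are equivalent). Two restraints $r,r'$ are equivalent, $r\simeq r'$, if there are an automorphism $\phi$ of $G$ and a bijection $f:\bigcup_u r(u)\to\bigcup_u r'(u)$ with $f(r(u))=r'(\phi(u))$ for every vertex $u$. *)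

(* Defs.v *)
From HB Require Import structures.
From mathcomp Require Import all_boot all_order all_fingroup.
From mathcomp Require Import finmap.

Set Implicit Arguments.
Unset Strict Implicit.
Unset Printing Implicit Defensive.

Local Open Scope fset_scope.

(* A finite simple graph is a finite vertex type with a symmetric irreflexive *)
(* adjacency relation e.                                                      *)
Section Restraints.

Variables (T : finType) (e : rel T).

Definition connected_graph : Prop := forall u v : T, connect e u v.

Definition bipartition (V1 V2 : {set T}) : Prop :=
  [/\ V1 :|: V2 = [set: T],
      V1 :&: V2 = set0,
      {in V1 &, forall u v, ~~ e u v}
    & {in V2 &, forall u v, ~~ e u v}].

Definition restraint := T -> {fset nat}.

Definition k_restraint (k : nat) (r : restraint) : Prop :=
  forall v, #|` r v| = k /\ (forall c, c \in r v -> 0 < c <= k * #|T|).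

(* The colours are 1, ..., x: the ordinal i : 'I_x stands for the colour i + 1. *)
Definition permitted_colouring (r : restraint) (x : nat)
    (c : {ffun T -> 'I_x}) : bool :=
  [forall u, forall v, e u v ==> (c u != c v)]
  && [forall v, (c v).+1 \notin r v].

Definition num_permitted (r : restraint) (x : nat) : nat :=
  #|[set c : {ffun T -> 'I_x} | permitted_colouring r c]|.

Definition Rmax (k : nat) (r : restraint) : Prop :=
  k_restraint k r /\
  forall r', k_restraint k r' ->
    exists N, forall x, N <= x -> num_permitted r' x <= num_permitted r x.

Definition alternating (V1 V2 : {set T}) (k : nat) (r : restraint) : Prop :=
  [/\ k_restraint k r,
      {in V1 &, forall u v, r u = r v},
      {in V2 &, forall u v, r u = r v}
    & forall u v, u \in V1 -> v \in V2 -> r u `&` r v = fset0].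

Definition graph_automorphism (phi : {perm T}) : Prop :=
  forall u v, e (phi u) (phi v) = e u v.

Definition colours (r : restraint) : {fset nat} := (\bigcup_(u <- enum T) r u)%fset.

(* The bijection between the colour sets is the restriction of f : nat -> nat. *)
Definition equiv_restraint (r r' : restraint) : Prop :=
  exists (phi : {perm T}) (f : nat -> nat),
    [/\ graph_automorphism phi,
        {in colours r &, injective f},
        [fset f c | c in colours r] = colours r'
      & forall u, [fset f c | c in r u] = r' (phi u)].

Lemma alternating_exists (V1 V2 : {set T}) (k : nat) :
  bipartition V1 V2 -> exists r, alternating V1 V2 k r.
Proof.
case=> V12 /eqP dis0 _ _.
have {dis0} dis := etrans (esym (setI_eq0 _ _)) dis0.
pose S m := [fset i in iota m k].
have cS m : #|` S m| = k.
  by rewrite card_fseq undup_id ?iota_uniq // size_iota.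
have inS m c : (c \in S m) = (m <= c < m + k) by rewrite in_fset /= mem_iota.
have side v : (v \in V2) = (v \notin V1).
  have := in_setT v; rewrite -V12 inE => /orP[v1|v2].
    by rewrite v1 (disjointFr dis v1).
  by rewrite v2 (disjointFl dis v2).
have [z z2|V20] := pickP (mem V2); last first.
  have all1 v : v \in V1 by apply: negbNE; rewrite -side; have /= -> := V20 v.
  exists (fun=> S 1); split=> // [v|u v _]; last by rewrite side all1.
  split=> // c; rewrite inS add1n ltnS => /andP[-> /leq_trans->] //.
  by rewrite leq_pmulr //; apply/card_gt0P; exists v.
have [y y1|V10] := pickP (mem V1); last first.
  exists (fun=> S 1); split=> // [v|u v]; last by have /= -> := V10 u.
  split=> // c; rewrite inS add1n ltnS => /andP[-> /leq_trans->] //.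
  by rewrite leq_pmulr //; apply/card_gt0P; exists v.
have yz : y != z by apply: contraTneq z2 => <-; rewrite /= side negbK.
have T2 : k + k <= k * #|T|.
  rewrite addnn -muln2 leq_mul2l; apply/orP; right.
  have <- : #|[set y; z]| = 2 by rewrite cards2 yz.
  exact: max_card.
exists (fun v => if v \in V1 then S 1 else S k.+1); split.
- move=> v; case: ifP => _; split=> // c; rewrite inS => /andP[lo hi].
    rewrite lo (leq_trans _ T2) // (leq_trans _ (leq_addr k k)) //.
  rewrite (leq_ltn_trans _ lo) // (leq_trans _ T2) //.
- by move=> u v -> ->.
- by move=> u v; rewrite !side => /negbTE-> /negbTE->.
- move=> u v u1; rewrite side => /negbTE->; rewrite u1.
  apply/fsetP => c; rewrite !inE /= !mem_iota add1n ltnS.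
  by case: (leqP c k) => //=; rewrite ?andbF // => /leq_gtF ->; rewrite andbF.
Qed.

End Restraints.

(* Main.v *)
Require Import Defs.
From HB Require Import structures.
From mathcomp Require Import all_boot all_order all_fingroup.
From mathcomp Require Import finmap zify.

Set Implicit Arguments.
Unset Strict Implicit.
Unset Printing Implicit Defensive.

(** Let [q = k * n], so that no restraint forbids a colour above [q], and let [y]
    be the number of colours above [q].  Sorting the colourings by the set [S] of
    vertices with a colour at most [q], the number of permitted colourings is the
    sum over [S] of [A_S * B_S], where [A_S] counts the colourings of [S] with
    colours at most [q] permitted by the restraint, and where
    [B_S = y ^ (n - #|S|) * (1 + O(1 / y))] does not depend on the restraint.
    Hence for large [y] the first size of [S] at which the [A_S] differ decides.
    For [#|S| <= 2], [A_S] is maximal exactly when the ends of each edge have disjoint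
    forbidden sets.  Among restraints with that property, for [#|S| = 3], [A_S] is
    maximal exactly when the ends of each path of length two have equal forbidden
    sets, there being no triangle.  In a connected bipartite graph the two conditions
    together say that the restraint is alternating, and any two alternating restraints
    differ by a permutation of the colours. *)

(** * Permutations of colours with prescribed images *)

(** Fibres over the same point have the same size, so they can be matched element by element in the
    order of their enumerations. *)
Lemma perm_eq_fibers (C D : finType) (g h : C -> D) :
    (forall d, #|[set x | g x == d]| = #|[set x | h x == d]|) ->
  exists s : {perm C}, forall x, h (s x) = g x.
Proof.
move=> gh; pose F (f : C -> D) d := enum [set x | f x == d].
have szF d : size (F g d) = size (F h d) by rewrite -!cardE gh.
have xF x : x \in F g (g x) by rewrite mem_enum inE.
(* The default [x] is never reached, by [ixF] below. *)
pose s x := nth x (F h (g x)) (index x (F g (g x))).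
have ixF x : index x (F g (g x)) < size (F h (g x)) by rewrite -szF index_mem.
have hs x : h (s x) = g x.
  by have := mem_nth x (ixF x); rewrite mem_enum inE => /eqP.
have s_inj : injective s.
  move=> x y sxy; have gxy : g x = g y by rewrite -!hs sxy.
  move: sxy (ixF x) (xF x); rewrite /s gxy => + ltx Fx.
  rewrite (set_nth_default x y) // => /eqP; rewrite nth_uniq ?enum_uniq //.
  by move=> /eqP/index_inj->.
by exists (perm s_inj) => x; rewrite permE.
Qed.

(** Apply the matching of fibres to the pair of membership tests: by disjointness, the sizes of the
    two sets determine the sizes of all four fibres. *)
Lemma perm_disjoint_pair (C : finType) (A B A' B' : {set C}) :
    A :&: B = set0 -> A' :&: B' = set0 -> #|A| = #|A'| -> #|B| = #|B'| ->
  exists s : {perm C},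
    (forall x, (s x \in A') = (x \in A)) /\ (forall x, (s x \in B') = (x \in B)).
Proof.
move=> AB AB' cA cB.
have cF (X Y : {set C}) : X :&: Y = set0 -> forall d : bool * bool,
  #|[set x | (x \in X, x \in Y) == d]| =
  match d with (true, true) => 0 | (true, false) => #|X|
  | (false, true) => #|Y| | (false, false) => #|C| - (#|X| + #|Y|) end.
  move=> XY d; have inXY x : (x \in X) && (x \in Y) = false.
    by rewrite -in_setI XY inE.
  case: d => [] [] [] /=.
  - by apply: eq_card0 => x; rewrite inE xpair_eqE !eqb_id inXY.
  - apply: eq_card => x; rewrite inE xpair_eqE; move: (inXY x).
    by case: (x \in X); case: (x \in Y).
  - apply: eq_card => x; rewrite inE xpair_eqE; move: (inXY x).
    by case: (x \in X); case: (x \in Y).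
  - rewrite -[#|X| + _]subn0 -(cards0 C) -XY -cardsU.
    rewrite -[X :|: Y]setCK -cardsCs; apply: eq_card => x.
    by rewrite !inE xpair_eqE; case: (x \in X); case: (x \in Y).
have [|s hs] := @perm_eq_fibers _ _ (fun x => (x \in A, x \in B))
   (fun x => (x \in A', x \in B')).
  by move=> d; rewrite !cF // cA cB.
by exists s; split=> x; case: (hs x).
Qed.

(** * Counting the permitted colourings of a set of vertices *)

Section PartialColourings.
Variables (T : finType) (e : rel T).
Hypotheses (e_sym : symmetric e) (e_irr : irreflexive e).

Section Counting.
Variable C : finType.
Implicit Types (R : T -> {set C}) (S : {set T}) (p : {ffun T -> option C}).

(** [None] marks the vertices outside [S], so that colourings of different sets share one type; the
    ends of an edge may then agree only by both being uncoloured. *)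
Definition partial_colouring R S p : bool :=
  [&& [forall v, (v \in S) == isSome (p v)],
      [forall u, forall v, e u v ==> (p u == p v) ==> (p u == None)]
    & [forall v, forall c, (p v == Some c) ==> (c \notin R v)]].

Definition partial_colourings R S := [set p | partial_colouring R S p].

Lemma partial_colouringsP R S p :
  reflect [/\ forall v, (v \in S) = isSome (p v),
              forall u v c, e u v -> p u = Some c -> p v = Some c -> False
            & forall v c, p v = Some c -> c \notin R v]
          (p \in partial_colourings R S).
Proof.
rewrite inE; apply: (iffP and3P) => -[].
  move=> /forallP pS /forallP pe /forallP pR; split=> [v|u v c euv pu pv|v c pv].
  - exact/eqP.
  - by have /forallP/(_ v) := pe u; rewrite euv pu pv eqxx.
  - by have /forallP/(_ c) := pR v; rewrite pv eqxx.
move=> pS pe pR; split.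
- by apply/forallP => v; rewrite pS.
- apply/forallP => u; apply/forallP => v; apply/implyP => euv.
  apply/implyP => /eqP puv; case pu: (p u) => [c|] //.
  by case: (pe u v c euv pu); rewrite -puv.
- apply/forallP => v; apply/forallP => c; apply/implyP => /eqP; exact: pR.
Qed.

Lemma card_partial_colourings0 R : #|partial_colourings R set0| = 1.
Proof.
rewrite (_ : partial_colourings R set0 = [set [ffun=> None]]) ?cards1 //.
apply/setP => p; rewrite in_set1; apply/partial_colouringsP/eqP.
  by case=> p0 _ _; apply/ffunP => v; rewrite ffunE; have := p0 v; rewrite inE; case: (p v).
by move=> ->; split=> [v|u v c|v c]; rewrite ?inE ffunE.
Qed.

(** Splitting off the colour of [w] is a bijection onto these pairs, with inverse [ext]. All later
    counts extend a colouring by one vertex at a time through it. *)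
Lemma card_partial_colouringsU1 R S w : w \notin S ->
  #|partial_colourings R (w |: S)| =
  #|[set pc in setX (partial_colourings R S) (~: R w) |
      [forall v in S, e v w ==> (pc.1 v != Some pc.2)]]|.
Proof.
move=> wS.
pose ext (pc : {ffun T -> option C} * C) : {ffun T -> option C} :=
  [ffun v => if v == w then Some pc.2 else pc.1 v].
rewrite -(@card_in_imset _ _ ext); last first.
  move=> [p c] [p' c']; rewrite !inE => /andP[/andP[pS _] _] /andP[/andP[pS' _] _].
  have {pS}/partial_colouringsP[pS _ _] : p \in partial_colourings R S by rewrite inE.
  have {pS'}/partial_colouringsP[pS' _ _] : p' \in partial_colourings R S by rewrite inE.
  move=> /ffunP pp'; have := pp' w; rewrite !ffunE eqxx => -[] /= ->.
  congr (_, _); apply/ffunP => v; have := pp' v; rewrite !ffunE.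
  case: eqP => // -> _; have := pS w; have := pS' w.
  by rewrite (negbTE wS); case: (p w); case: (p' w).
apply: eq_card => p; apply/idP/imsetP.
  move=> /partial_colouringsP[pS pe pR].
  case pw: (p w) (pS w) => [c|]; rewrite !inE eqxx //= => _.
  exists ([ffun v => if v == w then None else p v], c); last first.
    by apply/ffunP => v; rewrite !ffunE; case: eqP => // ->.
  rewrite in_set in_setX in_setC /= pR // andbT.
  apply/andP; split; last first.
    apply/forall_inP => v vS; apply/implyP => evw; rewrite ffunE.
    by case: ifP => // _; apply/eqP => pv; apply: (pe v w c).
  apply/partial_colouringsP; split=> [v|u v d euv|v d]; rewrite !ffunE.
  - case: eqP => [->|/eqP vw]; first by rewrite (negbTE wS).
    by rewrite -pS !inE (negbTE vw).
  - by case: eqP => // _ pu; case: eqP => // _; apply: pe pu.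
  - by case: eqP => // _; apply: pR.
move=> [[p' c]]; rewrite in_set in_setX in_setC => /andP[/andP[/=]].
move=> /partial_colouringsP[pS pe pR] cR /forall_inP pw ->.
have pw' v : e v w -> p' v = Some c -> False.
  move=> evw pv; have vS : v \in S by rewrite pS pv.
  by have := pw v vS; rewrite evw pv eqxx.
apply/partial_colouringsP; split=> [v|u v d euv|v d]; rewrite !ffunE.
- by rewrite !inE pS; case: eqP.
- case: eqP euv => [-> ewv [<-]|_ euv pu].
    case: eqP ewv => [->|_ ewv]; first by rewrite e_irr.
    by apply: pw'; rewrite e_sym.
  case: eqP euv => [-> euw [cd]|_ euv]; last exact: pe pu.
  by apply: (pw' u euw); rewrite cd.
- by case: eqP => [-> [<-]|_]; last exact: pR.
Qed.

Lemma card_partial_colourings_isolated R S w :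
    w \notin S -> {in S, forall v, ~~ e v w} ->
  #|partial_colourings R (w |: S)| = #|partial_colourings R S| * #|~: R w|.
Proof.
move=> wS nbr; rewrite card_partial_colouringsU1 // -cardsX.
apply: eq_card => pc; rewrite in_set andb_idr // => _.
by apply/forall_inP => v vS; rewrite (negbTE (nbr v vS)).
Qed.

(* Deletion-contraction of the edge [v w]: contracting merges the forbidden sets of its ends. *)
Lemma card_partial_colourings_leaf R S v w :
    w \notin S -> v \in S -> e v w -> {in S, forall u, e u w -> u = v} ->
  #|partial_colourings R (w |: S)|
    + #|partial_colourings [eta R with v |-> R v :|: R w] S|
  = #|partial_colourings R S| * #|~: R w|.
Proof.
move=> wS vS evw leaf; rewrite card_partial_colouringsU1 // -cardsX.
set X := setX _ _.
(* The clashing pairs: [v] and [w] share a colour, which must therefore avoid both forbidden sets,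
   and the second component is determined by the first. *)
pose Y := [set pc : {ffun T -> option C} * C | pc.1 v == Some pc.2].
rewrite -(cardsID Y X) addnC; congr (_ + _).
  have fst_inj : {in X :&: Y &, injective fst}.
    move=> [p c] [p' c'] /setIP[_]; rewrite inE => /= /eqP pv /setIP[_].
    by rewrite inE /= => /eqP + pp'; rewrite -pp' pv => -[->].
  rewrite -(card_in_imset fst_inj); apply: eq_card => p; apply/idP/imsetP.
    move=> /partial_colouringsP[pS pe pR].
    case pv: (p v) (pS v) => [c|]; rewrite vS // => _.
    have := pR v c pv; rewrite /= eqxx inE negb_or => /andP[cv cw].
    exists (p, c) => //; rewrite in_setI in_setX in_setC cw andbT [_ \in Y]in_set /= pv eqxx andbT.
    apply/partial_colouringsP; split=> // u d pu.
    by have := pR u d pu; rewrite /=; case: eqP => // ->; rewrite inE negb_or => /andP[].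
  move=> [[p' c]]; rewrite in_setI in_setX in_setC => /andP[/andP[/=]].
  move=> /partial_colouringsP[pS pe pR] cR; rewrite inE /= => /eqP pv ->.
  apply/partial_colouringsP; split=> // u d pu /=; case: eqP pu => [->|_]; last exact: pR.
  by rewrite pv inE negb_or => -[<-]; rewrite (pR _ _ pv).
apply: eq_card => pc; rewrite in_set in_setD andbC; congr (_ && _).
rewrite [pc \in Y]in_set.
apply/forall_inP/idP => [/(_ v vS)|pv u uS]; first by rewrite evw.
by apply/implyP => /(leaf _ uS) ->.
Qed.

Lemma card_partial_colourings1 R v : #|partial_colourings R [set v]| = #|~: R v|.
Proof.
rewrite -(setU0 [set v]) card_partial_colourings_isolated ?inE //.
  by rewrite card_partial_colourings0 mul1n.
by move=> u; rewrite inE.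
Qed.

Lemma card_partial_colourings_edge R u v : e u v ->
  #|partial_colourings R [set u; v]| + #|~: (R u :|: R v)| = #|~: R u| * #|~: R v|.
Proof.
move=> euv; have uv : u != v by apply: contraTneq euv => ->; rewrite e_irr.
have := @card_partial_colourings_leaf R [set v] v u.
rewrite !inE eqxx e_sym !card_partial_colourings1 /= eqxx (setUC (R v)) mulnC.
by apply=> // x /set1P.
Qed.

(** Remove the leaf [w] by deletion-contraction, then apply the edge formula to the contracted
    graph, in which [v] forbids [R v :|: R w]. Negative terms are moved across to avoid truncated
    subtraction. *)
Lemma card_partial_colourings_path R u v w :
    e u v -> e v w -> u != w -> ~~ e u w ->
  #|partial_colourings R (w |: [set u; v])| + #|~: R u| * #|~: (R v :|: R w)|
  = #|partial_colourings R [set u; v]| * #|~: R w| + #|~: (R u :|: (R v :|: R w))|.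
Proof.
move=> euv evw uw neuw.
have uv : u != v by apply: contraTneq euv => ->; rewrite e_irr.
have vw : v != w by apply: contraTneq evw => ->; rewrite e_irr.
have := @card_partial_colourings_leaf R [set u; v] v w.
rewrite !inE eqxx orbT eq_sym (negbTE uw) eq_sym (negbTE vw) => <- //; last first.
  by move=> x /set2P[->|//]; rewrite (negbTE neuw).
rewrite -addnA; congr (_ + _).
have := @card_partial_colourings_edge [eta R with v |-> R v :|: R w] u v euv.
by rewrite /= eqxx (negbTE uv).
Qed.

End Counting.

(** * Comparing two restraints on sets of at most three vertices *)

Section Comparison.
Variables (C : finType) (k : nat) (R R' : T -> {set C}).
Hypotheses (Rk : forall v, #|R v| = k) (R'k : forall v, #|R' v| = k).
Hypothesis R_edge : forall u v, e u v -> [disjoint R u & R v].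

Let cardC v : #|~: R v| = #|~: R' v|.
Proof. by rewrite [LHS]cardsCs [RHS]cardsCs !setCK Rk R'k. Qed.

Lemma card_partial_colourings_le1 (S : {set T}) : #|S| <= 1 ->
  #|partial_colourings R' S| = #|partial_colourings R S|.
Proof.
rewrite leq_eqVlt ltnS leqn0 => /orP[/cards1P[v ->]|/eqP/cards0_eq->].
  by rewrite !card_partial_colourings1 cardC.
by rewrite !card_partial_colourings0.
Qed.

Lemma cardsCU_edge u v : e u v ->
  #|~: (R u :|: R v)| + #|R' u :&: R' v| = #|~: (R' u :|: R' v)|.
Proof.
move=> euv; have := R_edge euv; rewrite -setI_eq0 => /eqP d.
have := cardsC (R u :|: R v); have := cardsC (R' u :|: R' v).
have := cardsUI (R u) (R v); have := cardsUI (R' u) (R' v).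
rewrite d cards0 !Rk !R'k; lia.
Qed.

(** In the edge formula all terms but the complement of the union depend only on [k], so what [R']
    loses is exactly its overlap. This yields both the inequality and its strict case. *)
Lemma card_partial_colourings_edge_cmp u v : e u v ->
  #|partial_colourings R' [set u; v]| + #|R' u :&: R' v|
  = #|partial_colourings R [set u; v]|.
Proof.
move=> euv; have := card_partial_colourings_edge R euv.
have := card_partial_colourings_edge R' euv; have := cardsCU_edge euv.
rewrite !cardC; lia.
Qed.

Lemma card_partial_colourings_le2 (S : {set T}) : #|S| <= 2 ->
  #|partial_colourings R' S| <= #|partial_colourings R S|.
Proof.
rewrite leq_eqVlt ltnS => /orP[/cards2P[u [v [uv ->]]]|/card_partial_colourings_le1->//].
have [euv|neuv] := boolP (e u v).
  by rewrite -(card_partial_colourings_edge_cmp euv) leq_addr.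
have iso (Q : T -> {set C}) := @card_partial_colourings_isolated C Q [set v] u.
rewrite !iso ?inE // => [|x /set1P->|x /set1P->]; rewrite ?[e v u]e_sym //.
by rewrite !card_partial_colourings1 !cardC.
Qed.

Hypothesis R_path : forall u v w, e u v -> e v w -> R u = R w.
Hypothesis R'_edge : forall u v, e u v -> [disjoint R' u & R' v].

Lemma card_partial_colourings_edge_eq u v : e u v ->
  #|partial_colourings R' [set u; v]| = #|partial_colourings R [set u; v]|.
Proof.
move=> euv; rewrite -(card_partial_colourings_edge_cmp euv).
by have := R'_edge euv; rewrite -setI_eq0 => /eqP->; rewrite cards0 addn0.
Qed.

(** Once edges have disjoint forbidden sets, only the triple union in the path formula can vary. The
    middle set is disjoint from the other two and adds exactly [k], so the count is largest when the
    two ends agree. The subtraction of [k] is never truncated. *)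
Lemma card_partial_colourings_path_cmp u v w :
    e u v -> e v w -> u != w -> ~~ e u w ->
  #|partial_colourings R' (w |: [set u; v])| + (#|R' u :|: R' w| - k)
  = #|partial_colourings R (w |: [set u; v])|.
Proof.
move=> euv evw uw neuw.
have := card_partial_colourings_path R euv evw uw neuw.
have := card_partial_colourings_path R' euv evw uw neuw.
rewrite card_partial_colourings_edge_eq // !cardC.
have -> : #|~: (R v :|: R w)| = #|~: (R' v :|: R' w)|.
  rewrite -cardsCU_edge //; have := R'_edge evw; rewrite -setI_eq0 => /eqP->.
  by rewrite cards0 addn0.
suff : #|~: (R' u :|: (R' v :|: R' w))| + (#|R' u :|: R' w| - k)
        = #|~: (R u :|: (R v :|: R w))| by lia.
have U (Q : T -> {set C}) : (forall x, #|Q x| = k) ->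
    (forall x y, e x y -> [disjoint Q x & Q y]) ->
    #|Q u :|: (Q v :|: Q w)| = #|Q u :|: Q w| + k.
  move=> Qk Qe; rewrite (setUC (Q v)) setUA cardsU Qk setIUl.
  have := Qe _ _ euv; rewrite -setI_eq0 => /eqP->.
  have := Qe _ _ evw; rewrite disjoint_sym -setI_eq0 => /eqP->.
  by rewrite setU0 cards0 subn0.
have := cardsC (R u :|: (R v :|: R w)); have := cardsC (R' u :|: (R' v :|: R' w)).
rewrite !U // (R_path euv evw) setUid Rk.
have : k <= #|R' u :|: R' w| by rewrite -(R'k u) subset_leq_card ?subsetUl.
lia.
Qed.

Hypothesis e_triangle : forall u v w, e u v -> e v w -> ~~ e u w.

(** Three vertices either include an isolated one, which contributes an independent factor and
    leaves a smaller set, or form a path, as there is no triangle. *)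
Lemma card_partial_colourings_le3 (S : {set T}) : #|S| <= 3 ->
  #|partial_colourings R' S| <= #|partial_colourings R S|.
Proof.
rewrite leq_eqVlt ltnS => /orP[/eqP S3|]; last exact: card_partial_colourings_le2.
have [/exists_inP[w wS /forall_inP iso]|] :=
  boolP [exists w in S, [forall v in S, ~~ e v w]].
  have cSw : #|S :\ w| <= 2 by have := cardsD1 w S; rewrite wS S3; lia.
  rewrite -(setD1K wS) !card_partial_colourings_isolated ?setD11 //; last first.
  - by move=> v /setD1P[_ /iso].
  - by move=> v /setD1P[_ /iso].
  by rewrite cardC leq_mul2r card_partial_colourings_le2 // orbT.
move/exists_inPn => noiso.
have nbr w : w \in S -> exists2 v, v \in S & e v w.
  by move=> /noiso; rewrite negb_forall_in => /exists_inP[v vS]; rewrite negbK; exists v.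
have path u v w : u \in S -> v \in S -> w \in S -> e u v -> e v w -> u != w ->
    #|partial_colourings R' S| <= #|partial_colourings R S|.
  move=> uS vS wS euv evw uw.
  suff -> : S = w |: [set u; v].
    by rewrite -(card_partial_colourings_path_cmp euv evw) ?leq_addr ?(e_triangle euv evw).
  apply/esym/eqP; rewrite eqEcard S3 !subUset !sub1set wS uS vS /=.
  have uv : u != v by apply: contraTneq euv => ->; rewrite e_irr.
  have wv : w != v by apply: contraTneq evw => ->; rewrite e_irr.
  by rewrite cardsU1 cards2 !inE negb_or uv wv eq_sym uw.
have [a aS] : exists a, a \in S by apply/set0Pn; rewrite -cards_eq0 S3.
have [b bS eba] := nbr a aS.
have ab : a != b by apply: contraTneq eba => ->; rewrite e_irr.
have [c] : exists c, c \in S :\: [set a; b].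
  apply/set0Pn; rewrite -cards_eq0 cardsD S3.
  have : #|S :&: [set a; b]| <= 2 by rewrite (leq_trans (subset_leq_card (subsetIr _ _))) ?cards2 ?ab.
  lia.
rewrite !inE negb_or => /andP[/andP[ca cb] cS].
have [d dS edc] := nbr c cS.
have [da|da] := eqVneq d a.
  by apply: (path b a c); rewrite // -?da // eq_sym.
have [db|db] := eqVneq d b.
  by apply: (path a b c); rewrite // -?db // 1?eq_sym // e_sym db.
have cd : c != d by apply: contraTneq edc => ->; rewrite e_irr.
(* In the remaining case [a], [b], [c], [d] would be four distinct vertices of [S]. *)
have : #|[set a; b] :|: [set c; d]| <= #|S|.
  by apply: subset_leq_card; rewrite !subUset !sub1set aS bS cS dS.
rewrite cardsU !cards2 ab cd S3 (_ : _ :&: _ = set0) ?cards0 //.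
apply/setP => x; rewrite !inE; apply/negP => /andP[/orP[]/eqP-> /orP[]/eqP/eqP].
- by rewrite eq_sym (negbTE ca).
- by rewrite eq_sym (negbTE da).
- by rewrite eq_sym (negbTE cb).
- by rewrite eq_sym (negbTE db).
Qed.

End Comparison.
End PartialColourings.

(** * Low and high colours, and the behaviour for many high colours *)

Section Asymptotics.
Variables (T : finType) (e : rel T).
Hypothesis e_irr : irreflexive e.

Section Unrestrained.
Variable C : finType.

(** For [C := 'I_y] and the set [~: S], the cardinality is the factor [B_S]. *)
Definition proper_partial (S : {set T}) := partial_colourings e (fun=> set0 : {set C}) S.

Let supp (S : {set T}) : {set {ffun T -> option C}} := [set p in pffun_on None S isSome].

Let card_supp S : #|supp S| = #|C| ^ #|S|.
Proof.
rewrite cardsE card_pffun_on; congr (_ ^ _).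
have := cardC1 (None : option C); rewrite card_option /= => <-.
by apply: eq_card => -[].
Qed.

Let suppP (S : {set T}) (p : {ffun T -> option C}) :
  reflect (forall v, (v \in S) = isSome (p v)) (p \in supp S).
Proof.
rewrite in_set; apply: (iffP pffun_onP) => [[pS1 pS2] v|pS].
  apply/idP/idP => [vS|pv]; first exact/pS2/image_f.
  have /subsetP := pS1; apply.
  by rewrite inE; case: (p v) pv.
split=> [|_ /imageP[v vS ->]]; last by rewrite -topredE /= -pS.
by apply/subsetP => v; rewrite inE pS; case: (p v).
Qed.

Lemma card_proper_partial_le (S : {set T}) : #|proper_partial S| <= #|C| ^ #|S|.
Proof.
rewrite -card_supp; apply: subset_leq_card; apply/subsetP => p.
by move=> /partial_colouringsP[pS _ _]; apply/suppP.
Qed.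

(** A union bound: an improper assignment repeats a colour on some pair of vertices, and each pair
    spoils at most a fraction [1 / #|C|] of the assignments. The extra factor [#|C|] on both sides
    clears this denominator. *)
Lemma card_proper_partial_ge (S : {set T}) :
  #|C| ^ #|S| * #|C| <= #|proper_partial S| * #|C| + #|T| ^ 2 * #|C| ^ #|S|.
Proof.
pose bad (uv : T * T) :=
  [set p in supp S | [&& uv.2 \in S, uv.1 != uv.2 & p uv.1 == p uv.2]].
have card_bad uv : #|bad uv| * #|C| <= #|C| ^ #|S|.
  case: uv => u v; have [vS|vS] := boolP (v \in S); last first.
    by rewrite (eq_card0 (_ : bad _ =i pred0)) // => p; rewrite in_set (negbTE vS) andbF.
  have := cardsD1 v S; rewrite vS add1n => ->; rewrite expnSr leq_mul2r; apply/orP; right.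
  (* Erasing the colour of [v] loses nothing on [bad (u, v)], since [u] still carries it. *)
  pose del (p : {ffun T -> option C}) : {ffun T -> option C} :=
    [ffun x => if x == v then None else p x].
  rewrite -card_supp -(@card_in_imset _ _ del).
    apply: subset_leq_card; apply/subsetP => _ /imsetP[p + ->].
    rewrite in_set => /andP[/suppP pS _]; apply/suppP => x.
    by rewrite !inE ffunE; case: eqP => //= _; rewrite pS.
  move=> p p'; rewrite !in_set => /andP[_ /and3P[_ /= uv /eqP puv]].
  move=> /andP[_ /and3P[_ /= _ /eqP puv']] /ffunP pp'; apply/ffunP => x.
  have [->|xv] := eqVneq x v; last by have := pp' x; rewrite !ffunE (negbTE xv).
  by rewrite -puv -puv'; have := pp' u; rewrite !ffunE (negbTE uv).
have cover : #|C| ^ #|S| <= #|proper_partial S| + \sum_uv #|bad uv|.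
  rewrite -card_supp; apply: (@leq_trans #|proper_partial S :|: \bigcup_uv bad uv|).
    apply: subset_leq_card; apply/subsetP => p pS; rewrite in_setU.
    have [//|/negP np] := boolP (p \in proper_partial S); apply/bigcupP.
    suff /existsP[[u v] /and3P[uS euv puv]] :
        [exists uv, [&& uv.1 \in S, e uv.1 uv.2 & p uv.1 == p uv.2]].
      exists (u, v) => //; rewrite in_set pS puv /= andbT; move/suppP: pS => pS.
      rewrite pS -(eqP puv) -pS uS /=.
      by apply: contraTneq euv => ->; rewrite e_irr.
    apply: contra_notT np; rewrite negb_exists => /forallP ok.
    have {}pS := suppP _ _ pS.
    apply/partial_colouringsP; split=> // [u v c euv pu pv|v c]; last by rewrite inE.
    by have := ok (u, v); rewrite /= euv pu pv eqxx pS pu.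
  apply: leq_trans (leq_card_setU _ _) _; rewrite leq_add2l.
  elim/big_rec2: _ => [|uv m A _ le]; first by rewrite cards0.
  by apply: leq_trans (leq_card_setU _ _) _; rewrite leq_add2l.
have bads : (\sum_uv #|bad uv|) * #|C| <= #|T| ^ 2 * #|C| ^ #|S|.
  rewrite big_distrl /= -mulnn -card_prod -sum_nat_const; exact: leq_sum.
have := leq_mul2r #|C| (#|C| ^ #|S|) (#|proper_partial S| + \sum_uv #|bad uv|).
rewrite cover orbT mulnDl; lia.
Qed.

End Unrestrained.

(** Sets of size at most [d] never favour [A], and [S0] alone gains [A'] at least [B_S0], of order
    at least [y ^ (n - d)]. The sets larger than [d] contribute only [O(y ^ (n - d - 1))]. *)
Lemma weighted_proper_partial_lt (A A' : {set T} -> nat) (d : nat) (S0 : {set T}) :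
    (forall S : {set T}, #|S| <= d -> A S <= A' S) -> #|S0| <= d -> A S0 < A' S0 ->
  exists N, forall y, N <= y ->
    \sum_S A S * #|proper_partial 'I_y (~: S)|
      < \sum_S A' S * #|proper_partial 'I_y (~: S)|.
Proof.
(* The sum bounds the coefficient of what larger sets can cost, and [#|T| ^ 2] is the error in the
   lower bound for [B_S0]. *)
move=> leA S0d ltA; exists (\sum_S A S + #|T| ^ 2).+1 => y Ny.
pose b (S : {set T}) := #|proper_partial 'I_y (~: S)|.
have y_gt0 : 0 < y by lia.
have cS (S : {set T}) : y ^ #|~: S| * y ^ #|S| = y ^ #|T| by rewrite -expnD addnC cardsC.
have b_le S : b S * y ^ #|S| <= y ^ #|T|.
  by rewrite -(cS S) leq_mul2r -[X in X ^ #|~: _|]card_ord card_proper_partial_le orbT.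
have b_ge S : y ^ #|T| * y <= b S * y ^ #|S| * y + #|T| ^ 2 * y ^ #|T|.
  have := card_proper_partial_ge 'I_y (~: S); rewrite card_ord -/(b S) => h.
  have := leq_mul2r (y ^ #|S|) (y ^ #|~: S| * y) (b S * y + #|T| ^ 2 * y ^ #|~: S|).
  rewrite h orbT -(cS S) mulnDl; lia.
change (\sum_S A S * b S < \sum_S A' S * b S).
pose big := \sum_(S : {set T}) (d < #|S|) * (A S * b S).
have : \sum_S A S * b S + b S0 <= \sum_S A' S * b S + big.
  have -> : b S0 = \sum_S (S == S0) * b S.
    by rewrite (bigD1 S0) //= eqxx mul1n big1 ?addn0 // => S /negbTE->.
  rewrite -!big_split; apply: leq_sum => S _ /=.
  have [->|SS0] := eqVneq S S0; last first.
    case: (ltnP d #|S|) => Sd; first by lia.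
    by rewrite !addn0 leq_mul2r leA ?orbT.
  by rewrite mul1n addnC -mulSn (leq_trans _ (leq_addr _ _)) // leq_mul2r ltA orbT.
suff : big < b S0 by lia.
(* Multiplying by [y ^ d.+1] allows comparison with [y ^ #|T|] without differences of exponents. *)
have y_d : 0 < y ^ d.+1 by rewrite expn_gt0 y_gt0.
rewrite -(ltn_pmul2r y_d); apply: (@leq_ltn_trans ((\sum_S A S) * y ^ #|T|)).
  rewrite !big_distrl; apply: leq_sum => S _ /=.
  case: ltnP => [dS|_]; rewrite // mul1n -mulnA leq_mul2l; apply/orP; right.
  by apply: leq_trans (b_le S); rewrite leq_mul2l leq_pexp2l ?orbT.
have yn : 0 < y ^ #|T| by rewrite expn_gt0 y_gt0.
apply: (@leq_trans (b S0 * y ^ #|S0| * y)).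
  have := b_ge S0; have : (\sum_S A S + #|T| ^ 2).+1 * y ^ #|T| <= y ^ #|T| * y.
    by rewrite mulnC leq_mul2l Ny orbT.
  rewrite mulSn mulnDl; lia.
by rewrite -mulnA -expnSr leq_mul2l leq_pexp2l ?orbT.
Qed.

Definition forbidden (r : restraint T) (x : nat) (v : T) : {set 'I_x} :=
  [set i : 'I_x | i.+1 \in r v].

(** A colouring is cut into its low part, on [S], and its high part, on [~: S]. The parts are
    independent: a low and a high colour never clash, and no high colour is forbidden. *)
Lemma num_permitted_low_high (r : restraint T) (q y : nat) :
    (forall v c, c \in r v -> c <= q) ->
  num_permitted e r (q + y) =
  \sum_S #|partial_colourings e (forbidden r q) S| * #|proper_partial 'I_y (~: S)|.
Proof.
move=> rq.
pose lo (c : {ffun T -> 'I_(q + y)}) : {ffun T -> option 'I_q} :=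
  [ffun v => if split (c v) is inl i then Some i else None].
pose hi (c : {ffun T -> 'I_(q + y)}) : {ffun T -> option 'I_y} :=
  [ffun v => if split (c v) is inr i then Some i else None].
have loP c v i : (lo c v == Some i) = (c v == lshift y i).
  rewrite ffunE -[c v]splitK; case: (split (c v)) => j; rewrite unsplitK /=.
    by rewrite (inj_eq Some_inj) (inj_eq (@lshift_inj _ _)).
  by rewrite eq_rlshift.
have hiP c v i : (hi c v == Some i) = (c v == rshift q i).
  rewrite ffunE -[c v]splitK; case: (split (c v)) => j; rewrite unsplitK /=.
    by rewrite eq_lrshift.
  by rewrite (inj_eq Some_inj) (inj_eq (@rshift_inj _ _)).
have lohi c v : isSome (hi c v) = ~~ isSome (lo c v).
  by rewrite !ffunE; case: split.
pose low c := [set v | isSome (lo c v)].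
rewrite /num_permitted -sum1_card (partition_big low predT) //=.
apply: eq_bigr => S _; rewrite sum1dep_card -cardsX.
have split_inj : injective (fun c => (lo c, hi c)).
  move=> c c' [/ffunP cl /ffunP ch]; apply/ffunP => v.
  have := cl v; have := ch v; rewrite [in RHS]ffunE [in LHS]ffunE.
  case Ec: (split (c v)) => [i|i]; case Ec': (split (c' v)) => [j|j] //.
    move=> _; rewrite [in RHS]ffunE [in LHS]ffunE Ec Ec' => -[ij].
    by rewrite -[c v]splitK -[c' v]splitK Ec Ec' ij.
  by move=> [ij] _; rewrite -[c v]splitK -[c' v]splitK Ec Ec' ij.
rewrite -(card_imset _ split_inj); apply: eq_card => -[p s].
rewrite in_setX; apply/imsetP/andP => [[c cS [-> ->]]|[]].
  have /andP[/andP[/forallP ce /forallP cr] /eqP <-] :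
    permitted_colouring e r c && (low c == S) by move: cS; rewrite !in_set.
  have ceP u v : e u v -> c u = c v -> False.
    by move=> euv cuv; have /forallP/(_ v) := ce u; rewrite euv cuv eqxx.
  split; apply/partial_colouringsP; split=> [v|u v i euv /eqP + /eqP|v i /eqP].
  - by rewrite inE.
  - by rewrite !loP => /eqP cu /eqP cv; apply: (ceP u v); rewrite ?cu.
  - by rewrite loP in_set => /eqP cv; have := cr v; rewrite cv.
  - by rewrite !inE lohi.
  - by rewrite !hiP => /eqP cu /eqP cv; apply: (ceP u v); rewrite ?cu.
  - by rewrite inE.
move=> /partial_colouringsP[pS pe pr] /partial_colouringsP[sS se sr].
(* Gluing: exactly one of [p v] and [s v] is defined. Choosing vertex by vertex needs no default
   colour, and ['I_(q + y)] might be empty. *)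
have [c cP] : exists c : forall v : T, 'I_(q + y), forall v,
    (forall i, p v = Some i -> c v = lshift y i) /\
    (forall j, s v = Some j -> c v = rshift q j).
  apply: (@fin_all_exists T (fun=> 'I_(q + y)) (fun v x =>
    (forall i, p v = Some i -> x = lshift y i) /\
    (forall j, s v = Some j -> x = rshift q j))) => v.
  have := sS v; rewrite inE pS.
  case: (p v) => [i|] /=; case: (s v) => [j|] //= _.
    by exists (lshift y i); split=> // _ [<-].
  by exists (rshift q j); split=> // _ [<-].
have lopE : lo (finfun c) = p.
  apply/ffunP => v; have [cp cs] := cP v; have := sS v; rewrite inE pS.
  rewrite !ffunE; case: (p v) cp => [i /(_ i erefl)->|_ /=]; first by rewrite (unsplitK (inl i)).
  by case: (s v) cs => // j /(_ j erefl)-> _; rewrite (unsplitK (inr j)).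
have hisE : hi (finfun c) = s.
  apply/ffunP => v; have [cp cs] := cP v; have := sS v; rewrite inE pS.
  rewrite !ffunE; case: (s v) cs => [i /(_ i erefl)->|_ /=]; first by rewrite (unsplitK (inr i)).
  by case: (p v) cp => // j /(_ j erefl)-> _; rewrite (unsplitK (inl j)).
exists (finfun c); last by rewrite lopE hisE.
rewrite !in_set; apply/andP; split; last first.
  by apply/eqP/setP => v; rewrite inE lopE pS.
have col v : (exists2 i, p v = Some i & finfun c v = lshift y i) \/
             (exists2 j, s v = Some j & finfun c v = rshift q j).
  rewrite ffunE; have [cp cs] := cP v; have := sS v; rewrite inE pS.
  case: (p v) cp => [i /(_ i erefl) -> _|_ /=]; first by left; exists i.
  by case: (s v) cs => // j /(_ j erefl) -> _; right; exists j.
apply/andP; split; apply/forallP => u.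
  apply/forallP => v; apply/implyP => euv; apply/eqP.
  have [[i pu ->]|[i su ->]] := col u; have [[j pv ->]|[j sv ->]] := col v.
  - by move=> /lshift_inj ij; apply: (pe u v i euv pu); rewrite ij.
  - by move/eqP; rewrite eq_lrshift.
  - by move/eqP; rewrite eq_rlshift.
  - by move=> /rshift_inj ij; apply: (se u v i euv su); rewrite ij.
have [[i pu ->]|[i su ->]] := col u.
  by have := pr u i pu; rewrite in_set.
by apply/negP => /rq /=; lia.
Qed.

End Asymptotics.

(** * The two local conditions and their invariance under equivalence *)

Section Alternating.
Local Open Scope fset_scope.
Variables (T : finType) (e : rel T).
Hypotheses (e_sym : symmetric e) (e_irr : irreflexive e).
Implicit Types r : restraint T.

(** Boolean, like the next condition, so that a failure yields an explicit edge or path. *)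
Definition edge_disjoint r := [forall u, forall v, e u v ==> [disjoint r u & r v]%fset].

Definition neighbours_agree r :=
  [forall u, forall v, forall w, e u v ==> e v w ==> (r u == r w)].

Lemma edge_disjointP r :
  reflect (forall u v, e u v -> r u `&` r v = fset0) (edge_disjoint r).
Proof.
apply: (iffP forallP) => [rd u v euv|rd u].
  by have /forallP/(_ v)/implyP/(_ euv)/eqP := rd u.
by apply/forallP => v; apply/implyP => /rd/eqP.
Qed.

Lemma neighbours_agreeP r :
  reflect (forall u v w, e u v -> e v w -> r u = r w) (neighbours_agree r).
Proof.
apply: (iffP forallP) => [ra u v w euv evw|ra u].
  by have /forallP/(_ v)/forallP/(_ w) := ra u; rewrite euv evw => /eqP.
apply/forallP => v; apply/forallP => w.
by apply/implyP => euv; apply/implyP => evw; apply/eqP/(ra u v w).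
Qed.

Lemma mem_colours r c : reflect (exists u, c \in r u) (c \in colours r).
Proof.
apply: (iffP (bigfcupP _ _ _ _)) => [[u _ cu]|[u cu]]; first by exists u.
by exists u; rewrite // mem_enum.
Qed.

Lemma equiv_restraint_edge_disjoint r r' :
  equiv_restraint e r r' -> edge_disjoint r' -> edge_disjoint r.
Proof.
move=> [phi [f [phiP f_inj _ fr]]] /edge_disjointP r'd; apply/edge_disjointP => u v euv.
apply/eqP/negPn/negP => /fset0Pn[c]; rewrite in_fsetI => /andP[cu cv].
have : f c \in r' (phi u) `&` r' (phi v) by rewrite in_fsetI -!fr !in_imfset.
by rewrite r'd ?phiP.
Qed.

Lemma equiv_restraint_neighbours_agree r r' :
  equiv_restraint e r r' -> neighbours_agree r' -> neighbours_agree r.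
Proof.
move=> [phi [f [phiP f_inj _ fr]]] /neighbours_agreeP r'a.
apply/neighbours_agreeP => u v w euv evw.
have fuw : [fset f c | c in r u] = [fset f c | c in r w].
  by rewrite !fr; apply: (r'a _ (phi v)); rewrite phiP.
have sub x y : [fset f c | c in r x] = [fset f c | c in r y] -> {subset r x <= r y}.
  move=> fxy c cx; have : f c \in [fset f c | c in r x] by rewrite in_imfset.
  rewrite fxy => /imfsetP[c' /= c'y /f_inj->] //; apply/mem_colours.
    by exists x.
  by exists y.
by apply/fsetP => c; apply/idP/idP; apply: sub.
Qed.

Section Forbidden.
Variables (r : restraint T) (x : nat) (v : T).
Hypothesis rx : forall c, c \in r v -> 0 < c <= x.

Lemma mem_restraintP c :
  reflect (exists2 i : 'I_x, i \in forbidden r x v & c = i.+1) (c \in r v).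
Proof.
apply: (iffP idP) => [cr|[i + ->]]; last by rewrite inE.
have /andP[c_gt0 cx] := rx cr; have ix : c.-1 < x by lia.
by exists (Ordinal ix); rewrite ?inE /= prednK.
Qed.

Lemma card_forbidden : #|forbidden r x v| = #|` r v|.
Proof.
rewrite cardE -(size_map (fun i : 'I_x => i.+1)); apply/perm_size/uniq_perm.
- by rewrite map_inj_uniq ?enum_uniq // => i j [] /val_inj.
- exact: fset_uniq.
move=> c; apply/mapP/mem_restraintP => -[i]; first by rewrite mem_enum; exists i.
by exists i; rewrite ?mem_enum.
Qed.

End Forbidden.

(** * Alternating restraints on bipartite graphs *)

Section Bipartite.
Variables V1 V2 : {set T}.
Hypothesis V_bip : bipartition e V1 V2.

Lemma bipartition_side v : (v \in V2) = (v \notin V1).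
Proof.
have [V12 V12' _ _] := V_bip; have : v \in V1 :|: V2 by rewrite V12 inE.
have : v \in V1 :&: V2 = false by rewrite V12' inE.
by rewrite !inE; case: (v \in V1); case: (v \in V2).
Qed.

Lemma edge_sides u v : e u v -> (v \in V1) = (u \notin V1).
Proof.
move=> euv; have [_ _ d1 d2] := V_bip.
have [u1|u1] := boolP (u \in V1); have [v1|v1] //= := boolP (v \in V1).
  by have := d1 u v u1 v1; rewrite euv.
by have := d2 u v; rewrite !bipartition_side euv => /(_ u1 v1).
Qed.

Lemma bipartite_triangle_free u v w : e u v -> e v w -> ~~ e u w.
Proof.
move=> euv evw; apply/negP => euw; have := edge_sides euw.
by rewrite (edge_sides evw) (edge_sides euv); case: (u \in V1).
Qed.

Section AlternatingLocal.
Variables (k : nat) (r : restraint T).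

Lemma alternating_edge_disjoint : alternating V1 V2 k r -> edge_disjoint r.
Proof.
case=> _ _ _ r12; apply/edge_disjointP => u v euv; have := edge_sides euv.
have [u1|u2] := boolP (u \in V1); rewrite /= => v1.
  by apply: r12; rewrite ?bipartition_side ?v1.
by rewrite fsetIC; apply: r12; rewrite ?bipartition_side ?v1.
Qed.

Lemma alternating_neighbours_agree : alternating V1 V2 k r -> neighbours_agree r.
Proof.
case=> _ r1 r2 _; apply/neighbours_agreeP => u v w euv evw.
have := edge_sides evw; rewrite (edge_sides euv) negbK => wu.
have [u1|u2] := boolP (u \in V1); first by apply: r1; rewrite ?wu.
by apply: r2; rewrite bipartition_side ?wu.
Qed.

Hypothesis e_conn : connected_graph e.

Lemma neighbours_agree_side u v : neighbours_agree r ->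
  (u \in V1) = (v \in V1) -> r u = r v.
Proof.
move=> /neighbours_agreeP ra.
(* Sides alternate along a path from [u], so the induction must also cover ends [v] on the other
   side, where it is the neighbours of [v] that agree with [u]. *)
suff [] : ((u \in V1) = (v \in V1) -> r u = r v) /\
          ((u \in V1) != (v \in V1) -> forall w, e v w -> r u = r w) by [].
have /connectP[p ep ->] := e_conn u v.
elim/last_ind: p ep => [|p x IHp]; first by rewrite /= eqxx.
rewrite rcons_path last_rcons => /andP[/IHp[IH1 IH2] exl].
rewrite (edge_sides exl); split=> [ux|ux w exw].
  by apply: IH2 exl; rewrite ux; case: (_ \in _).
by rewrite IH1 ?(ra _ _ _ exl exw) //; move: ux; do 2!case: (_ \in _).
Qed.

(** Connectedness makes [r] constant on each side; the first edge of a path from one side to the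
    other then gives disjointness for the two sides as a whole. *)
Lemma local_alternating : k_restraint k r ->
  edge_disjoint r -> neighbours_agree r -> alternating V1 V2 k r.
Proof.
move=> rk /edge_disjointP rd ra; split=> // u v.
- by move=> u1 v1; apply: neighbours_agree_side; rewrite ?u1.
- by rewrite !bipartition_side => /negbTE u1 /negbTE v1; apply: neighbours_agree_side; rewrite ?u1.
rewrite bipartition_side => u1 v1; have /connectP[p] := e_conn u v.
case: p => [_ uv|w p /= /andP[euw _] _]; first by rewrite uv u1 in v1.
rewrite (@neighbours_agree_side v w) ?rd // (edge_sides euw) u1.
exact/negbTE.
Qed.

End AlternatingLocal.

Section Permutation.
Variables (k : nat) (r r' : restraint T).
Hypotheses (rP : alternating V1 V2 k r) (r'P : alternating V1 V2 k r').

(** An alternating restraint amounts to a pair of disjoint colour sets, one for each side, with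
    sizes fixed by [k] and by which sides are empty. *)
Lemma alternating_perm x : k * #|T| <= x ->
  exists s : {perm 'I_x}, forall v i,
    (s i \in forbidden r' x v) = (i \in forbidden r x v).
Proof.
(* The set common to all of [V]; the value [set0] covers an empty side, as in the graph with one
   vertex. *)
move=> kx; pose side (V : {set T}) (q : restraint T) :=
  if [pick u in V] is Some u then forbidden q x u else set0.
have rng (q : restraint T) : k_restraint k q -> forall v c, c \in q v -> 0 < c <= x.
  by move=> qk v c /(qk v).2/andP[-> /leq_trans->].
have sideE (V : {set T}) q : {in V &, forall u v, q u = q v} ->
    forall v, v \in V -> forbidden q x v = side V q.
  rewrite /side => qV v vV; case: pickP => [u uV|/(_ v)]; last by rewrite vV.
  by apply/setP => i; rewrite !inE (qV u v).
have card_side (V : {set T}) : #|side V r| = #|side V r'|.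
  rewrite /side; case: pickP => [u _|//]; have [rk _ _ _] := rP; have [r'k _ _ _] := r'P.
  by rewrite !card_forbidden ?(rk u).1 ?(r'k u).1 //; apply: rng.
have disj q : alternating V1 V2 k q -> side V1 q :&: side V2 q = set0.
  move=> [_ _ _ q12]; apply/setP => i; rewrite /side.
  case: pickP => [u u1|_]; case: pickP => [v v2|_]; rewrite ?inE ?andbF //.
  by rewrite -in_fsetI q12.
have [s [s1 s2]] := perm_disjoint_pair (disj r rP) (disj r' r'P) (card_side V1) (card_side V2).
exists s => v i; have [_ r1 r2 _] := rP; have [_ r'1 r'2 _] := r'P.
have [v1|v1] := boolP (v \in V1); first by rewrite !(sideE V1).
by rewrite !(sideE V2) // bipartition_side.
Qed.

Lemma alternating_num_permitted_le x : k * #|T| <= x ->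
  num_permitted e r x <= num_permitted e r' x.
Proof.
move=> /alternating_perm[s sP].
pose recolour (c : {ffun T -> 'I_x}) := [ffun v => s (c v)].
have recolour_inj : injective recolour.
  move=> c c' /ffunP cc'; apply/ffunP => v; have := cc' v; rewrite !ffunE.
  exact: perm_inj.
rewrite /num_permitted -(card_imset _ recolour_inj); apply: subset_leq_card.
apply/subsetP => _ /imsetP[c + ->]; rewrite !in_set => /andP[/forallP ce /forallP cr].
apply/andP; split; apply/forallP => u; last first.
  by have := sP u (c u); rewrite !inE ffunE => ->.
by apply/forallP => v; rewrite !ffunE (inj_eq perm_inj); have /forallP := ce u.
Qed.

Lemma alternating_equiv : equiv_restraint e r r'.
Proof.
have [s sP] := alternating_perm (leqnn _).
pose f c := if insub c.-1 is Some i then (s i).+1 else 0.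
have fE (i : 'I_(k * #|T|)) : f i.+1 = (s i).+1 by rewrite /f /= valK.
have [rk _ _ _] := rP; have [r'k _ _ _] := r'P.
have memr v c := mem_restraintP (rk v).2 c; have memr' v c := mem_restraintP (r'k v).2 c.
have fr u : [fset f c | c in r u] = r' u.
  apply/fsetP => c; apply/imfsetP/memr' => [[d /memr[i ir ->] ->]|[i ir' ->]].
    by exists (s i); rewrite ?sP ?fE.
  exists ((s^-1)%g i).+1; last by rewrite fE permKV.
  by apply/memr; exists ((s^-1)%g i); rewrite // -sP permKV.
exists 1%g, f; split.
- by move=> u v; rewrite !perm1.
- move=> c d /mem_colours[u /memr[i _ ->]] /mem_colours[v /memr[j _ ->]].
  by rewrite !fE => -[] /val_inj/perm_inj->.
- apply/fsetP => c; apply/imfsetP/mem_colours => [[d /mem_colours[u du] ->]|[u]].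
    by exists u; rewrite -fr in_imfset.
  by rewrite -fr => /imfsetP[d du ->]; exists d => //; apply/mem_colours; exists u.
- by move=> u; rewrite perm1.
Qed.

End Permutation.

(** A violated condition supplies the deciding set [S0]: an edge with [d = 2] if disjointness fails,
    otherwise a path with [d = 3]. *)
Lemma num_permitted_lt (k : nat) (r r' : restraint T) :
    k_restraint k r -> k_restraint k r' -> edge_disjoint r -> neighbours_agree r ->
    ~~ (edge_disjoint r' && neighbours_agree r') ->
  exists N, forall x, N <= x -> num_permitted e r' x < num_permitted e r x.
Proof.
move=> rk r'k rd ra nr'; pose q := k * #|T|.
have rng (p : restraint T) : k_restraint k p -> forall v c, c \in p v -> 0 < c <= q.
  by move=> pk v c /(pk v).2.
have card_f (p : restraint T) : k_restraint k p -> forall v, #|forbidden p q v| = k.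
  by move=> pk v; rewrite card_forbidden ?(pk v).1 //; apply: rng.
have disj_f (p : restraint T) : edge_disjoint p ->
    forall u v, e u v -> [disjoint forbidden p q u & forbidden p q v]%bool.
  move=> /edge_disjointP pd u v euv; rewrite -setI_eq0; apply/eqP/setP => i.
  by rewrite !inE -in_fsetI pd.
have path_f u v w : e u v -> e v w -> forbidden r q u = forbidden r q w.
  by move=> euv evw; apply/setP => i; rewrite !inE ((neighbours_agreeP _ ra) u v w).
pose A (p : restraint T) S := #|partial_colourings e (forbidden p q) S|.
suff [d [S0 [leA S0d ltA]]] : exists d, exists S0 : {set T},
    [/\ forall S : {set T}, #|S| <= d -> A r' S <= A r S, #|S0| <= d & A r' S0 < A r S0].
  have [N HN] := weighted_proper_partial_lt e_irr leA S0d ltA.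
  exists (q + N)%N => x Nx; have qx : q <= x by apply: leq_trans Nx; rewrite leq_addr.
  rewrite -(subnKC qx) !num_permitted_low_high => [|v c /(rng r rk)/andP[]//|].
    by apply: HN; lia.
  by move=> v c /(rng r' r'k)/andP[].
have [r'd|] := boolP (edge_disjoint r'); last first.
  rewrite negb_forall => /existsP[u]; rewrite negb_forall => /existsP[v].
  rewrite negb_imply => /andP[euv] /fset0Pn[c]; rewrite in_fsetI => /andP[cu cv].
  exists 2, [set u; v]; split.
  - by apply: card_partial_colourings_le2 => //; eauto.
  - by rewrite cards2; case: eqP.
  rewrite /A -(card_partial_colourings_edge_cmp _ _ (card_f r rk) (card_f r' r'k)) //; last by eauto.
  rewrite -addn1 leq_add2l card_gt0; apply/set0Pn.
  have /(mem_restraintP (rng r' r'k u))[i iu ci] := cu.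
  by exists i; rewrite inE iu inE -ci.
move: nr'; rewrite r'd /= negb_forall => /existsP[u].
rewrite negb_forall => /existsP[v]; rewrite negb_forall => /existsP[w].
rewrite !negb_imply => /and3P[euv evw ruw].
have uw : u != w by apply: contraNneq ruw => ->.
exists 3, (w |: [set u; v]); split.
- apply: card_partial_colourings_le3; eauto; exact: bipartite_triangle_free.
- by rewrite cardsU1 cards2; case: (_ \in _); case: eqP.
rewrite /A -(card_partial_colourings_path_cmp _ _ (card_f r rk) (card_f r' r'k)) //; eauto; last first.
  exact: bipartite_triangle_free evw.
(* The two ends have sets of equal size, so an inclusion between them would be an equality; hence
   their union has more than [k] elements. *)
rewrite -addn1 leq_add2l subn_gt0 -{1}(card_f r' r'k u) proper_card // properUl //.
apply: contra ruw => wu; have {wu} : forbidden r' q w = forbidden r' q u.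
  by apply/eqP; rewrite eqEcard wu !(card_f r' r'k) leqnn.
move=> /setP wu; apply/eqP/fsetP => c.
apply/(mem_restraintP (rng r' r'k u))/(mem_restraintP (rng r' r'k w)).
  by move=> [i iu ->]; exists i; rewrite ?wu.
by move=> [i iw ->]; exists i; rewrite -?wu.
Qed.

End Bipartite.
End Alternating.

(** * Characterisation of the maximising restraints *)

Theorem theorem4p7 (T : finType) (e : rel T)
    (e_sym : symmetric e) (e_irr : irreflexive e)
    (e_conn : connected_graph e)
    (V1 V2 : {set T}) (V_bip : bipartition e V1 V2)
    (k : nat) (k_gt0 : 0 < k)
    (r_alt : restraint T) (r_altP : alternating V1 V2 k r_alt)
    (r : restraint T) (rP : k_restraint k r) :
  Rmax e k r <-> equiv_restraint e r r_alt.
Proof.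
have alt_d := alternating_edge_disjoint V_bip r_altP.
have alt_a := alternating_neighbours_agree V_bip r_altP.
have [altk _ _ _] := r_altP; split.
  move=> [_ rmax]; apply: (alternating_equiv V_bip _ r_altP).
  (* If [r] violated a condition, [r_alt] would beat it strictly for all large [x], against
     maximality. *)
  have [/andP[rd ra]|nr] := boolP (edge_disjoint e r && neighbours_agree e r).
    exact: (local_alternating V_bip).
  have [N HN] := num_permitted_lt e_sym e_irr V_bip altk rP alt_d alt_a nr.
  have [M HM] := rmax _ altk.
  have := HN (N + M) (leq_addr _ _); have := HM (N + M) (leq_addl _ _).
  by rewrite leqNgt => /negbTE->.
move=> req; have rd := equiv_restraint_edge_disjoint req alt_d.
have ra := equiv_restraint_neighbours_agree req alt_a.
have r_alternating : alternating V1 V2 k r by exact: (local_alternating V_bip).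
split=> // r' r'P.
(* A competitor meeting both conditions is alternating and is matched through a recolouring; any
   other is eventually strictly worse. *)
have [/andP[r'd r'a]|nr'] := boolP (edge_disjoint e r' && neighbours_agree e r').
  exists (k * #|T|) => x; apply: (alternating_num_permitted_le V_bip _ r_alternating).
  exact: (local_alternating V_bip).
have [N HN] := num_permitted_lt e_sym e_irr V_bip rP r'P rd ra nr'.
by exists N => x /HN/ltnW.
Qed.
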